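(* Let $k\ge2$ and $\beta\ge\bar\beta_k$, where $$\bar\beta_k=\frac{(\gamma_1\vee\mu_{11}\vee\mu_{12})^{k+1}}{\mu_{22}\,(\gamma_1\wedge\mu_{11}\wedge\mu_{12})^k}.$$ There exist positive constants $C_1$ and $C_2$ depending only on $k$ and $\beta$ such that $$\mathcal L^U\mathcal V_{k,\beta}(x)\;\le\;C_1-C_2\,\mathcal V_{k,\beta}(x)\qquad\forall\,U\in\mathcal U,\ \forall\,x\in\mathbb R^2,$$ where $\mathcal U$ is the class of admissible controls $U=(U^c,U^s)$ with $U^c\equiv(1,0)$ and $U^s$ arbitrary.
   Context: **Parameters.** $\lambda_i,\nu_j>0$, $\mu_{11},\mu_{12},\mu_{22}>0$, $\gamma_1>0$, $\gamma_2\ge0$, $\hat\lambda_i,\hat\mu_{ij}\in\mathbb R$ are fixed limiting parameters of an N-network in the Halfin–Whitt regime, with $\lambda_1>\mu_{11}\nu_1$ and $\frac{\lambda_1-\mu_{11}\nu_1}{\mu_{12}\nu_2}+\frac{\lambda_2}{\mu_{22}\nu_2}=1$. Put $z_{11}^*=\nu_1$, $z_{12}^*=\frac{\lambda_1-\mu_{11}\nu_1}{\mu_{12}}$, $z_{22}^*=\frac{\lambda_2}{\mu_{22}}$. Constants may depend on these fixed parameters. **Controlled diffusion.** $e=(1,1)^{\mathsf T}$; $a\wedge b$, $a\vee b$ are min and max, $a^+=a\vee0$, $a^-=-(a\wedge0)$. $\mathbb U=\{u=(u^c,u^s)\in\mathbb R_+^2\times\mathbb R_+^2:e\cdot u^c=e\cdot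 u^s=1\}$. The diffusion on $\mathbb R^2$ is $dX_t=b(X_t,U_t)dt+\Sigma\,dW_t$, $W$ a standard 2-dimensional Wiener process, $b(x,u)=-B_1(x-(e\cdot x)^+u^c)+(e\cdot x)^-B_2u^s-(e\cdot x)^+\Gamma u^c+\ell$, with $B_1=\mathrm{diag}(\mu_{12},\mu_{22})$, $B_2=\mathrm{diag}(\mu_{11}-\mu_{12},0)$, $\Gamma=\mathrm{diag}(\gamma_1,\gamma_2)$, $\ell_1=\hat\lambda_1-\hat\mu_{11}z_{11}^*-\hat\mu_{12}z_{12}^*$, $\ell_2=\hat\lambda_2-\hat\mu_{22}z_{22}^*$, $\Sigma=\mathrm{diag}(\sqrt{2\lambda_1},\sqrt{2\lambda_2})$. Admissible controls are $\mathbb U$-valued processes, jointly measurable in $(t,\omega)$ and non-anticipative. The controlled generator is $\mathcal L^uf(x)=\sum_{i=1}^2[\lambda_i\partial_{ii}f(x)+b_i(x,u)\partial_if(x)]$, $u\in\mathbb U$; $\mathcal L^Uf(x)$ denotes $\mathcal L^uf(x)$ evaluated at the (arbitrary) value $u$ of the control $U$, so the assertion is a pointwise bound, uniform over all values $u=((1,0),u^s)\in\mathbb U$. **Lyapunov function.** $\mathcal V_{k,\beta}(x)=|x_1|^k+\beta|x_2|^k$, $x\in\mathbb R^2$. *)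

(* Defs.v *)
From HB Require Import structures.
From mathcomp Require Import all_boot all_order all_algebra.
From mathcomp Require Import all_classical all_reals all_analysis.

Set Implicit Arguments.
Unset Strict Implicit.
Unset Printing Implicit Defensive.

Import Order.TTheory GRing.Theory Num.Theory.
Import numFieldNormedType.Exports.

Local Open Scope classical_set_scope.
Local Open Scope ring_scope.

(* Limiting parameters of an N-network in the Halfin-Whitt regime: two customer
   classes, two server pools. The index sets {1, 2} are rendered by 'I_2, so
   that [lambda P 0] is lambda_1, [lambda P 1] is lambda_2, etc. Class 1 is
   served in both pools, class 2 in pool 2 only (there is no mu_21).
   [hlambda], [hmu11], [hmu12], [hmu22] are the parameters written with a hat. *)
Record nparams (R : Type) := NParams {
  lambda : 'I_2 -> R;
  nu : 'I_2 -> R;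
  mu11 : R;
  mu12 : R;
  mu22 : R;
  gamma : 'I_2 -> R;
  hlambda : 'I_2 -> R;
  hmu11 : R;
  hmu12 : R;
  hmu22 : R }.

Record admissible_nparams (R : realType) (P : nparams R) : Prop := {
  lambda_gt0 : forall i, 0 < lambda P i;
  nu_gt0 : forall j, 0 < nu P j;
  mu11_gt0 : 0 < mu11 P;
  mu12_gt0 : 0 < mu12 P;
  mu22_gt0 : 0 < mu22 P;
  gamma1_gt0 : 0 < gamma P 0;
  gamma2_ge0 : 0 <= gamma P 1;
  pool1_overload : mu11 P * nu P 0 < lambda P 0;
  pool2_critical :
    (lambda P 0 - mu11 P * nu P 0) / (mu12 P * nu P 1)
      + lambda P 1 / (mu22 P * nu P 1) = 1 }.

Section NNetwork.
Variables (R : realType) (P : nparams R).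
Implicit Types (a b r k beta : R) (x v w : 'cV[R]_2).

Definition zstar11 : R := nu P 0.
Definition zstar12 : R := (lambda P 0 - mu11 P * nu P 0) / mu12 P.
Definition zstar22 : R := lambda P 1 / mu22 P.

Definition pos_part a : R := Num.max a 0.
Definition neg_part a : R := - Num.min a 0.

Definition vec2 a b : 'cV[R]_2 := \col_i (if i == 0 then a else b).
Definition diag2 a b : 'M[R]_2 := diag_mx (vec2 a b)^T.
Definition dot v w : R := \sum_i v i 0 * w i 0.

Definition evec : 'cV[R]_2 := const_mx 1.

(* A control value u = (u^c, u^s). *)
Definition control : Type := ('cV[R]_2 * 'cV[R]_2)%type.

Definition controls : set control :=
  [set u : control | [/\ forall i, 0 <= u.1 i 0, forall i, 0 <= u.2 i 0,
               dot evec u.1 = 1 & dot evec u.2 = 1]].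

Definition B1 : 'M[R]_2 := diag2 (mu12 P) (mu22 P).
Definition B2 : 'M[R]_2 := diag2 (mu11 P - mu12 P) 0.
Definition Gam : 'M[R]_2 := diag2 (gamma P 0) (gamma P 1).
Definition ell : 'cV[R]_2 :=
  vec2 (hlambda P 0 - hmu11 P * zstar11 - hmu12 P * zstar12)
       (hlambda P 1 - hmu22 P * zstar22).

Definition drift x (u : control) : 'cV[R]_2 :=
  - (B1 *m (x - pos_part (dot evec x) *: u.1))
  + neg_part (dot evec x) *: (B2 *m u.2)
  - pos_part (dot evec x) *: (Gam *m u.1)
  + ell.

Definition partial (i : 'I_2) (f : 'cV[R]_2 -> R) : 'cV[R]_2 -> R :=
  fun x => 'D_(delta_mx i 0) f x.

(* The second order coefficient is (Sigma Sigma^T)_ii / 2 = lambda_i, since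
   Sigma = diag(sqrt(2 lambda_1), sqrt(2 lambda_2)). *)
Definition generator (u : control) (f : 'cV[R]_2 -> R) x : R :=
  \sum_(i < 2) (lambda P i * partial i (partial i f) x
                + drift x u i 0 * partial i f x).

(* The exponent k is real; [powR 0 k] is 0 for k != 0. *)
Definition lyapunov k beta x : R :=
  `|x 0 0| `^ k + beta * `|x 1 0| `^ k.

Definition beta_bar k : R :=
  (Num.max (Num.max (gamma P 0) (mu11 P)) (mu12 P)) `^ (k + 1)
  / (mu22 P * (Num.min (Num.min (gamma P 0) (mu11 P)) (mu12 P)) `^ k).

(* Values of the admissible controls whose u^c component is identically (1, 0).
   The generator bound is pointwise in the value of the control, so only
   these values matter. *)
Definition class1_controls : set control :=
  [set u : control | controls u /\ u.1 = vec2 1 0].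

End NNetwork.

(* Main.v *)
Require Import Defs.
From HB Require Import structures.
From mathcomp Require Import all_boot all_order all_algebra.
From mathcomp Require Import all_classical all_reals all_analysis.
From mathcomp Require Import ring lra.
Import Order.TTheory GRing.Theory Num.Theory.
Import numFieldNormedType.Exports.
Local Open Scope classical_set_scope.
Local Open Scope ring_scope.

(** Let m and M be the smallest and the largest of gamma_1, mu_11, mu_12.  When
    class 1 takes the whole queue, the drift has the form
      b_1 = - c x_1 + d x_2 + l_1,   b_2 = - mu_22 x_2 + l_2,
    where c and d change with the half-plane and with the control, but always
    m <= c and |d| <= M - m ([drift_class1], [drift_class1_bounds]).  The second
    coordinate is thus autonomous and mean-reverting, and the first one is
    mean-reverting up to the coupling d x_2.

    Applying the generator to |x_1|^k + beta |x_2|^k ([partial_lyapunov],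
    [partial2_lyapunov]) produces, up to the factor k, the degree k part
      - m |x_1|^k + (M - m) |x_1|^(k-1) |x_2| - beta mu_22 |x_2|^k
    and terms of degree k-1 and k-2.  The condition on beta says exactly that
    beta mu_22 >= M (M/m)^k ([beta_bar_mul]), and this gives
      M |x_1|^(k-1) |x_2| <= m |x_1|^k + beta mu_22 |x_2|^k
    by comparing M |x_2| with m |x_1|.  Since the coupling carries only M - m
    instead of M, a fraction m/M of the negative terms survives
    ([cross_term]).  Half of this fraction absorbs the terms of lower degree at
    the cost of a constant ([dominate_lower]); the other half is the claimed
    decay. *)

(** * Derivatives of powers of the absolute value *)

Lemma powR_norm_cvg0 {R : realType} (p : R) : 0 < p ->
  `|h| `^ p @[h --> (0 : R)^'] --> 0.
Proof.
move=> p0; apply/cvgrPdist_lt => e e0.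
have := @dnbhs0_lt R R _ (powR_gt0 p^-1 e0); apply: filterS => h he.
rewrite sub0r normrN ger0_norm ?powR_ge0//.
rewrite -[ltRHS]powRr1 ?ltW// -(mulVf (lt0r_neq0 p0)) powRrM.
by apply: gt0_ltr_powR; rewrite // nnegrE ?powR_ge0.
Qed.

(** The odd power y |y|^p is differentiable at every real, 0 included: there the
    difference quotient is |h|^p.  For p = 0 this is the identity map, whose
    derivative at 0 is 1; the formula agrees because the power 0^0 is 1.  With
    p = k - 2 it covers the second derivative of |y|^k down to k = 2, and
    through [is_derive_powR_norm] also the first one. *)
Lemma is_derive_mul_powR_norm {R : realType} (p x : R) : 0 <= p ->
  is_derive x 1 (fun y : R => y * `|y| `^ p) ((p + 1) * `|x| `^ p).
Proof.
move=> p0.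
have powS (y : R) : 0 < y -> y * y `^ p = y `^ (p + 1).
  by move=> y0; rewrite powRD ?(gt_eqF y0) ?implybT// powRr1 ?ltW// mulrC.
have negS (y : R) : y < 0 -> - (- y) `^ (p + 1) = y * `|y| `^ p.
  by move=> y0; rewrite ltr0_norm// -powS ?oppr_gt0// mulNr opprK.
have posD (y : R) : 0 < y -> is_derive y 1 ((@powR R)^~ (p + 1)) ((p + 1) * y `^ p).
  by move=> y0; apply: (is_derive_eq (is_derive1_powR (p + 1) y0)); rewrite addrK.
have [x0|x0|->] := ltgtP x 0.
- have nx0 : 0 < - x by rewrite oppr_gt0.
  apply: (@near_eq_is_derive _ _ _ (- ((@powR R)^~ (p + 1) \o -%R))).
    near=> y; have y0 : y < 0 by near: y; exact: lt_nbhsl.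
    exact: negS.
  rewrite ltr0_norm//.
  apply: (is_derive_eq (is_deriveN (is_derive1_comp (posD _ nx0)
            (is_deriveN (is_derive_id x 1))))).
  by rewrite mulrN1 opprK.
- apply: (@near_eq_is_derive _ _ _ ((@powR R)^~ (p + 1))).
    near=> y; have y0 : 0 < y by near: y; exact: lt_nbhsr.
    by rewrite gtr0_norm// powS.
  by rewrite gtr0_norm//; exact: posD.
- suff cv : h^-1 *: (((fun y : R => y * `|y| `^ p) \o shift 0) (h *: 1)
        - 0 * `|0 : R| `^ p) @[h --> (0 : R)^'] --> (p + 1) * `|0 : R| `^ p.
    by apply: DeriveDef; [exact: cvgP _ cv | exact: (cvg_lim (@Rhausdorff R) cv)].
  apply: cvg_trans (_ : `|h| `^ p @[h --> (0 : R)^'] --> _).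
    apply: near_eq_cvg; near=> h.
    have h0 : h != 0 by near: h; exact: nbhs_dnbhs_neq.
    by rewrite /= mul0r subr0 addr0 /GRing.scale /= mulr1 mulKf.
  have [->|pn0] := eqVneq p 0.
    by under eq_fun do rewrite powRr0; rewrite powRr0 add0r mulr1; exact: cvg_cst.
  by rewrite normr0 powR0// mulr0; apply: powR_norm_cvg0; rewrite lt_def pn0.
Unshelve. all: end_near. Qed.

Lemma powR_normE {R : realType} (k y : R) : 2 <= k ->
  `|y| `^ k = y * (y * `|y| `^ (k - 2)).
Proof.
move=> k2; have kn0 : k != 0 by lra.
have [->|y0] := eqVneq y 0; first by rewrite normr0 powR0// mul0r.
rewrite -[in LHS](subrK 2 k) (@powRD _ _ (k - 2) 2) ?normr_eq0 ?y0 ?implybT//.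
by rewrite (powR_mulrn 2 (normr_ge0 y)) real_normK ?num_real//; ring.
Qed.

(** The product rule for y (y |y|^(k-2)) avoids a second discussion of the
    point 0. *)
Lemma is_derive_powR_norm {R : realType} (k x : R) : 2 <= k ->
  is_derive x 1 (fun y : R => `|y| `^ k) (k * (x * `|x| `^ (k - 2))).
Proof.
move=> k2; have k20 : 0 <= k - 2 by lra.
have -> : (fun y : R => `|y| `^ k) = id * (fun y : R => y * `|y| `^ (k - 2)).
  by apply/funext => y; rewrite [RHS]/(_ * _) /= powR_normE.
apply: (is_derive_eq (is_deriveM (is_derive_id x 1)
   (is_derive_mul_powR_norm _ x k20))).
by rewrite /GRing.scale /=; ring.
Qed.

(** A directional derivative depends on the function only through its
    increments along the direction, so a partial derivative of a function of
    several variables reduces to a derivative on the line. *)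
Lemma derive_along {R : numFieldType} {V1 V2 W : normedModType R}
    (f : V1 -> W) (g : V2 -> W) (x v : V1) (y w : V2) :
  (forall h : R, f (h *: v + x) - f x = g (h *: w + y) - g y) ->
  'D_v f x = 'D_w g y.
Proof.
move=> fg; rewrite /derive.
suff -> : (fun h : R => h^-1 *: ((f \o shift x) (h *: v) - f x)) =
          (fun h : R => h^-1 *: ((g \o shift y) (h *: w) - g y)) by [].
by apply/funext => h /=; rewrite fg.
Qed.

(** * The Lyapunov function *)

Lemma sum_ord2 {V : nmodType} (F : 'I_2 -> V) : \sum_j F j = F 0 + F 1.
Proof.
by rewrite big_ord_recl big_ord1 (_ : lift ord0 ord0 = 1)//; exact: val_inj.
Qed.

Lemma partial_separable {R : realType} (F : 'I_2 -> R -> R) (i : 'I_2)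
    (x : 'cV[R]_2) :
  partial i (fun y => \sum_j F j (y j 0)) x = 'D_1 (F i) (x i 0).
Proof.
rewrite /partial; apply: derive_along => h.
rewrite -sumrB (bigD1 i)//= big1 ?addr0; last first.
  move=> j ji; rewrite !mxE (negbTE ji)/= mulr0 add0r subrr//.
by rewrite !mxE !eqxx.
Qed.

Lemma partial_coord {R : realType} (f : R -> R) (i : 'I_2) (x : 'cV[R]_2) :
  partial i (fun y => f (y i 0)) x = 'D_1 f (x i 0).
Proof.
by rewrite /partial; apply: derive_along => h; rewrite !mxE !eqxx.
Qed.

Lemma is_derive_scale {R : realType} (c : R) {x df : R} {f : R -> R} :
  is_derive x 1 f df -> is_derive x 1 (fun y => c * f y) (c * df).
Proof. exact: is_deriveZ. Qed.

(** Uniform notation for the coefficients 1 and beta of the two coordinates, so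
    that both are differentiated at once. *)
Definition weight {R : realType} (beta : R) (i : 'I_2) : R :=
  if i == 0 then 1 else beta.

Lemma lyapunov_sum {R : realType} (k beta : R) :
  lyapunov k beta = fun x => \sum_j weight beta j * `|x j 0| `^ k.
Proof.
by apply/funext => x; rewrite sum_ord2 /weight /= mul1r.
Qed.

Lemma partial_lyapunov {R : realType} (k beta : R) (i : 'I_2) (x : 'cV[R]_2) :
  2 <= k -> partial i (lyapunov k beta) x =
  weight beta i * (k * (x i 0 * `|x i 0| `^ (k - 2))).
Proof.
move=> k2; rewrite lyapunov_sum.
rewrite (partial_separable (fun j r => weight beta j * `|r| `^ k)).
have dx := is_derive_powR_norm k (x i 0) k2.
by rewrite (@derive_val _ _ _ _ _ _ _ (is_derive_scale (weight beta i) dx)).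
Qed.

Lemma partial2_lyapunov {R : realType} (k beta : R) (i : 'I_2) (x : 'cV[R]_2) :
  2 <= k -> partial i (partial i (lyapunov k beta)) x =
  weight beta i * (k * ((k - 1) * `|x i 0| `^ (k - 2))).
Proof.
move=> k2; have k20 : 0 <= k - 2 by lra.
have -> : partial i (lyapunov k beta) =
    fun y => weight beta i * (k * (y i 0 * `|y i 0| `^ (k - 2))).
  by apply/funext => y; exact: partial_lyapunov.
rewrite (partial_coord (fun r => weight beta i * (k * (r * `|r| `^ (k - 2))))).
have dx := is_derive_mul_powR_norm (k - 2) (x i 0) k20.
have {}dx := is_derive_scale (weight beta i) (is_derive_scale k dx).
rewrite (@derive_val _ _ _ _ _ _ _ dx).
by rewrite (_ : k - 2 + 1 = k - 1)//; ring.
Qed.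

(** * Power inequalities *)

(** Below the threshold K with K^(q-p) = 1/eps the left side is at most K^p;
    above it, a^q = a^(q-p) a^p is at least a^p / eps. *)
Lemma dominate_powR {R : realType} (p q eps : R) : 0 <= p -> p < q -> 0 < eps ->
  exists2 C : R, 0 < C & forall a, 0 <= a -> a `^ p <= C + eps * a `^ q.
Proof.
move=> p0 pq e0.
pose K := eps^-1 `^ (q - p)^-1.
have K0 : 0 < K by rewrite powR_gt0 ?invr_gt0.
exists (K `^ p) => [|a a0]; first exact: powR_gt0.
have [aK|Ka] := leP a K.
  apply: (@le_trans _ _ (K `^ p)).
    by apply: ge0_ler_powR; rewrite ?nnegrE// ltW.
  by rewrite lerDl mulr_ge0 ?powR_ge0// ltW.
have ap : 0 < a by apply: lt_trans Ka.
apply: (@le_trans _ _ (eps * a `^ q)); last by rewrite lerDr powR_ge0.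
rewrite -(subrK p q) powRD ?(gt_eqF ap) ?implybT// mulrA ler_peMl ?powR_ge0//.
have KE : eps^-1 = K `^ (q - p).
  by rewrite /K -powRrM mulVf ?powRr1 ?invr_ge0 ?ltW// subr_eq0 gt_eqF.
have eK : eps^-1 <= a `^ (q - p).
  by rewrite KE; apply: ge0_ler_powR; rewrite ?nnegrE ?subr_ge0// ltW.
by rewrite -(mulfV (lt0r_neq0 e0)) ler_wpM2l ?(ltW e0).
Qed.

Lemma dominate_lower {R : realType} (k A B eps : R) :
  2 <= k -> 0 <= A -> 0 <= B -> 0 < eps ->
  exists2 C : R, 0 < C & forall a, 0 <= a ->
    A * a `^ (k - 2) + B * a `^ (k - 1) <= C + eps * a `^ k.
Proof.
move=> k2 A0 B0 e0.
have step (c p : R) : 0 <= c -> 0 <= p -> p < k ->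
    exists2 C : R, 0 < C & forall a, 0 <= a ->
      c * a `^ p <= C + eps / 2 * a `^ k.
  move=> c0 p0 pk.
  have c10 : 0 < c + 1 by lra.
  have e'0 : 0 < eps / 2 / (c + 1) by rewrite !divr_gt0.
  have [C C0 CP] := dominate_powR p k _ p0 pk e'0.
  exists ((c + 1) * C) => [|a a0]; first exact: mulr_gt0.
  apply: (@le_trans _ _ ((c + 1) * a `^ p)).
    by rewrite ler_wpM2r ?powR_ge0// lerDl.
  apply: le_trans (ler_wpM2l (ltW c10) (CP a a0)) _.
  by rewrite mulrDr lerD2l mulrA [_ * (_ / _)]mulrC divfK// gt_eqF.
have [k20 k2k k10 k1k] : [/\ 0 <= k - 2, k - 2 < k, 0 <= k - 1 & k - 1 < k].
  by split; lra.
have [C1 C10 C1P] := step A (k - 2) A0 k20 k2k.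
have [C2 C20 C2P] := step B (k - 1) B0 k10 k1k.
exists (C1 + C2) => [|a a0]; first exact: addr_gt0.
move: (C1P a a0) (C2P a a0); lra.
Qed.

(** As M - m = (1 - m/M) M, it suffices to bound M a^(k-1) b.  If M b <= m a,
    the first term on the right alone is enough; otherwise a < (M/m) b turns
    everything into b^k, with the constant M (M/m)^(k-1) <= M (M/m)^k <= D. *)
Lemma cross_term {R : realType} (k m M D a b : R) :
  2 <= k -> 0 < m -> m <= M -> M * (M / m) `^ k <= D -> 0 <= a -> 0 <= b ->
  (M - m) * (a `^ (k - 1) * b) <= (1 - m / M) * (m * a `^ k + D * b `^ k).
Proof.
move=> k2 m0 mM hD a0 b0; have M0 : 0 < M by lra.
have k0 : 0 < k by lra.
have -> : M - m = (1 - m / M) * M by rewrite mulrBl divfK ?gt_eqF// mul1r.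
rewrite -mulrA ler_wpM2l// ?subr_ge0 ?ler_pdivrMr ?mul1r//.
have r1 : 1 <= M / m by rewrite ler_pdivlMr// mul1r.
have [ab|ab] := leP (M * b) (m * a).
  apply: (@le_trans _ _ (m * a `^ k)); last first.
    rewrite lerDl mulr_ge0 ?powR_ge0//; apply: le_trans hD.
    by rewrite mulr_ge0 ?powR_ge0// ltW.
  rewrite mulrCA -(mulr_powRB1 a0 k0) [leRHS]mulrA [leRHS]mulrC.
  by rewrite ler_wpM2l ?powR_ge0.
have arb : a <= M / m * b by rewrite mulrAC ler_pdivlMr// mulrC ltW.
apply: (@le_trans _ _ (D * b `^ k)); last first.
  by rewrite lerDr mulr_ge0 ?powR_ge0// ltW.
apply: (@le_trans _ _ (M * (M / m) `^ k * b `^ k)); last first.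
  by rewrite ler_wpM2r ?powR_ge0.
rewrite -mulrA ler_wpM2l ?(ltW M0)//.
apply: (@le_trans _ _ ((M / m * b) `^ (k - 1) * b)).
  rewrite ler_wpM2r//; apply: ge0_ler_powR; rewrite ?nnegrE//; first lra.
  by rewrite mulr_ge0//; lra.
rewrite powRM//; last lra.
rewrite -mulrA -(mulr_powRB1 b0 k0) [b * _]mulrC ler_wpM2r ?mulr_ge0 ?powR_ge0//.
by apply: ler_powR => //; lra.
Qed.

(** * The drift under class 1 controls *)

Definition rate_max {R : realType} (P : nparams R) : R :=
  Num.max (Num.max (gamma P 0) (mu11 P)) (mu12 P).
Definition rate_min {R : realType} (P : nparams R) : R :=
  Num.min (Num.min (gamma P 0) (mu11 P)) (mu12 P).

(** Under u^c = (1, 0) the drift is piecewise affine: class 1 forms the whole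
    queue and abandons at rate gamma_1 when e.x >= 0; otherwise the pools have
    idle servers, and the restoring rate of x_1 interpolates between mu_12 and
    mu_11 according to u^s_1. *)
Lemma drift_class1 {R : realType} (P : nparams R) (u : control R)
    (x : 'cV[R]_2) : class1_controls u ->
  drift P x u 0 0 =
    (if 0 <= x 0 0 + x 1 0
     then - gamma P 0 * x 0 0 + (mu12 P - gamma P 0) * x 1 0
     else - (mu12 P + (mu11 P - mu12 P) * u.2 0 0) * x 0 0
          - (mu11 P - mu12 P) * u.2 0 0 * x 1 0) + ell P 0 0
  /\ drift P x u 1 0 = - mu22 P * x 1 0 + ell P 1 0.
Proof.
move=> -[_ uc]; rewrite /drift uc.
have dotE : dot (evec R) x = x 0 0 + x 1 0.
  by rewrite /dot sum_ord2 !mxE !mul1r.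
rewrite dotE /B1 /B2 /Gam /diag2 !mul_diag_mx !mxE /= /pos_part /neg_part.
split; last ring.
by case: leP => h; ring.
Qed.

Lemma rate_bounds {R : realType} (P : nparams R) (r : R) :
  r \in [:: gamma P 0; mu11 P; mu12 P] -> rate_min P <= r <= rate_max P.
Proof.
rewrite !inE /rate_min /rate_max !ge_min !le_max.
by case/or3P => /eqP ->; rewrite !lexx ?orbT.
Qed.

(** In both half-planes c is a convex combination of the three rates, and d is a
    difference of two of them, possibly scaled by u^s_1 in [0, 1]. *)
Lemma drift_class1_bounds {R : realType} (P : nparams R) (u : control R)
    (x : 'cV[R]_2) : class1_controls u ->
  exists c d, [/\ rate_min P <= c, `|d| <= rate_max P - rate_min P &
    drift P x u 0 0 = - c * x 0 0 + d * x 1 0 + ell P 0 0].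
Proof.
move=> hu; have [-> _] := drift_class1 P u x hu.
have /andP[] : rate_min P <= gamma P 0 <= rate_max P.
  by apply: rate_bounds; rewrite !inE eqxx.
have /andP[] : rate_min P <= mu11 P <= rate_max P.
  by apply: rate_bounds; rewrite !inE eqxx orbT.
have /andP[] : rate_min P <= mu12 P <= rate_max P.
  by apply: rate_bounds; rewrite !inE eqxx !orbT.
move: (rate_min P) (rate_max P) => m M m12 M12 m11 M11 mg Mg.
case: ifP => _.
  by exists (gamma P 0), (mu12 P - gamma P 0); split=> //; rewrite ler_norml; lra.
have [[_ us0 _ us1] _] := hu.
have s0 := us0 0; have s1 := us0 1.
have {}us1 : u.2 0 0 + u.2 1 0 = 1.
  by move: us1; rewrite /dot sum_ord2 !mxE !mul1r.
move: (u.2 0 0) (u.2 1 0) s0 s1 us1 => s t s0 t0 st.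
exists (mu12 P + (mu11 P - mu12 P) * s), (- ((mu11 P - mu12 P) * s)); split.
- by nra.
- by rewrite normrN ler_norml; apply/andP; split; nra.
- by ring.
Qed.

(** Contribution of one coordinate to the first order part of the generator.
    Everything is read off w = x |x|^(k-2), for which x w = |x|^k and
    |w| = |x|^(k-1). *)
Lemma drift_term {R : realType} (k m c d e l x z : R) :
  2 <= k -> m <= c -> `|d| <= e ->
  (- c * x + d * z + l) * (x * `|x| `^ (k - 2)) <=
  - m * `|x| `^ k + e * (`|x| `^ (k - 1) * `|z|) + `|l| * `|x| `^ (k - 1).
Proof.
move=> k2 mc de.
have nw : `|x * `|x| `^ (k - 2)| = `|x| `^ (k - 1).
  rewrite normrM (ger0_norm (powR_ge0 _ _)).
  have -> : k - 2 = k - 1 - 1 by ring.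
  by rewrite mulr_powRB1//; lra.
rewrite -nw (powR_normE k x)//; move: nw; set w := x * _ => nw.
rewrite !mulrDl; apply: lerD; first apply: lerD.
- rewrite -mulrA; have : 0 <= x * w by rewrite -powR_normE// powR_ge0.
  by nra.
- apply: le_trans (ler_norm _) _; rewrite !normrM -mulrA [`|z| * _]mulrC.
  by rewrite ler_wpM2r// mulr_ge0.
- by apply: le_trans (ler_norm _) _; rewrite normrM.
Qed.

Lemma beta_bar_mul {R : realType} (P : nparams R) (k : R) :
  0 < rate_min P -> 0 < rate_max P -> 0 < mu22 P ->
  mu22 P * beta_bar P k =
    rate_max P * (rate_max P / rate_min P) `^ k.
Proof.
rewrite /beta_bar -/(rate_max P) -/(rate_min P).
move: (rate_min P) (rate_max P) (mu22 P) => m M mu m0 M0 mu0.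
have mk := powR_gt0 k m0.
have -> : M `^ (k + 1) = M * ((M / m) `^ k * m `^ k).
  rewrite -powRM ?divr_ge0 ?(ltW m0) ?(ltW M0)// divfK ?gt_eqF//.
  by rewrite powRD ?(gt_eqF M0) ?implybT// powRr1 ?(ltW M0)// mulrC.
by field; rewrite !gt_eqF.
Qed.

(** * The drift inequality *)

Theorem lemma4p1 (R : realType) (P : nparams R) (hP : admissible_nparams P)
    (k beta : R) (hk : 2 <= k) (hbeta : beta_bar P k <= beta) :
  exists C1 C2 : R, [/\ 0 < C1, 0 < C2 &
    forall u : control R, class1_controls u -> forall x : 'cV[R]_2,
      generator P u (lyapunov k beta) x <= C1 - C2 * lyapunov k beta x].
Proof.
have [l0 _ mu11p mu12p mu22p g0 _ _ _] := hP.
have m0 : 0 < rate_min P by rewrite !lt_min g0 mu11p.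
have mM : rate_min P <= rate_max P.
  by have /andP[/le_trans] := rate_bounds P (gamma P 0) (mem_head _ _); apply.
have M0 : 0 < rate_max P by exact: lt_le_trans mM.
have hD : rate_max P * (rate_max P / rate_min P) `^ k <= mu22 P * beta.
  by rewrite -beta_bar_mul// ler_wpM2l// ltW.
have b0 : 0 < beta.
  rewrite -(pmulr_rgt0 _ mu22p); apply: lt_le_trans hD.
  by rewrite mulr_gt0// powR_gt0// divr_gt0.
have th0 : 0 < rate_min P / rate_max P by rewrite divr_gt0.
have cross := cross_term k (rate_min P) (rate_max P) (mu22 P * beta) _ _
  hk m0 mM hD.
(* From here on only these bounds on m and M matter, with th = m / M. *)
move: (drift_class1_bounds P) m0 cross th0 {mM M0 hD}.
move: (rate_min P) (rate_max P) => m M bnd m0 cross.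
move: (m / M) cross => th cross th0.
have l1 := l0 0; have l2 := l0 1; have k0 : 0 < k by lra.
(* Half of the surviving rate of each coordinate is spent on its lower order
   terms. *)
have e1 : 0 < th * m / 2 by rewrite divr_gt0// mulr_gt0.
have e2 : 0 < th * mu22 P / 2 by rewrite divr_gt0// mulr_gt0.
have [|A A0 hA] := dominate_lower k ((k - 1) * lambda P 0) `|ell P 0 0| _
   hk _ (normr_ge0 _) e1.
  by rewrite mulr_ge0//; lra.
have [|B B0 hB] := dominate_lower k ((k - 1) * lambda P 1) `|ell P 1 0| _
   hk _ (normr_ge0 _) e2.
  by rewrite mulr_ge0//; lra.
exists (k * (A + beta * B)), (k * Num.min (th * m / 2) (th * mu22 P / 2)); split.
- by rewrite mulr_gt0// addr_gt0// mulr_gt0.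
- by rewrite mulr_gt0// lt_min e1.
move=> u hu x.
have [c [d [mc dM drE]]] := bnd u x hu.
have [_ drE2] := drift_class1 P u x hu.
rewrite /generator sum_ord2.
rewrite !partial2_lyapunov// !partial_lyapunov// drE drE2 /weight /= !mul1r.
have t1 := drift_term k m c d (M - m) (ell P 0 0) (x 0 0) (x 1 0) hk mc dM.
(* The second coordinate has no coupling term: d = 0, with 0 in place of the
   other coordinate. *)
have := drift_term k (mu22 P) (mu22 P) 0 0 (ell P 1 0) (x 1 0) 0 hk (lexx _).
rewrite normr0 => /(_ (lexx _)) t2.
have {}cross := cross `|x 0 0| `|x 1 0| (normr_ge0 _) (normr_ge0 _).
have {}hA := hA _ (normr_ge0 (x 0 0)); have {}hB := hB _ (normr_ge0 (x 1 0)).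
have p0 := powR_ge0 `|x 0 0| k; have q0 := powR_ge0 `|x 1 0| k.
rewrite /lyapunov; set mn := Num.min _ _.
have mn1 : mn <= th * m / 2 by rewrite ge_min lexx.
have mn2 : mn <= th * mu22 P / 2 by rewrite ge_min lexx orbT.
clearbody mn; clear drE drE2 bnd hu.
move: (ell P 0 0) (ell P 1 0) t1 t2 cross hA hB p0 q0 => ell0 ell1.
move: (lambda P 0) (lambda P 1) (mu22 P) mn2 => la0 la1 mu2 mn2.
move: (x 0 0) (x 1 0) => y z.
move: (y * `|y| `^ (k - 2)) (z * `|z| `^ (k - 2)) => w1 w2.
move: (`|y| `^ k) (`|z| `^ k) => p q.
move: (`|y| `^ (k - 1)) (`|z| `^ (k - 1)) => p1 q1.
move: (`|y| `^ (k - 2)) (`|z| `^ (k - 2)) => p2 q2.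
move: `|z| => nz.
move=> t1 t2 cross hA hB p0 q0.
(* Once these products are formed, the claim is linear in all the monomials. *)
have {}mn1 := ler_wpM2r p0 mn1.
have {}mn2 := ler_wpM2l (ltW b0) (ler_wpM2r q0 mn2).
have {}t2 := ler_wpM2l (ltW b0) t2.
have {}hB := ler_wpM2l (ltW b0) hB.
have inner : la0 * ((k - 1) * p2) + (- c * y + d * z + ell0) * w1 +
    beta * (la1 * ((k - 1) * q2) + (- mu2 * z + ell1) * w2) <=
    A + beta * B - mn * (p + beta * q) by lra.
by have := ler_wpM2l (ltW k0) inner; lra.
Qed.
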